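(* Let $m$ be an integer. For an integer $k$ let $F_k(X,Y)=X^3-kX^2Y-(k+3)XY^2-Y^3$ and let $L_k$ be the splitting field over $\mathbb{Q}$ of $f_k(X)=F_k(X,1)=X^3-kX^2-(k+3)X-1$. There exists an integer $n\in\mathbb{Z}\setminus\{m,-m-3\}$ such that $L_n=L_m$ if and only if there exist a positive divisor $\lambda$ of $m^2+3m+9$ and a pair $(x,y)\in\mathbb{Z}^2$ with $xy(x+y)\neq 0$ such that \[ F_m(x,y)=x^3-mx^2y-(m+3)xy^2-y^3=\lambda . \] Moreover, such an integer $n$ and such a solution $(x,y)$ can be chosen to satisfy \[ N=m+\frac{(m^2+3m+9)\,xy(x+y)}{F_m(x,y)}, \] where either $N=n$ or $N=-n-3$, and this occurs for only one of $n$ and $-n-3$.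
   Context: $L_k$ denotes the splitting field over $\mathbb{Q}$ of the polynomial $X^3-kX^2-(k+3)X-1$ (the ''simplest cubic field''). Solutions $(x,y)$ with $xy(x+y)=0$ are called trivial. *)

(* Defs.v *)
From HB Require Import structures.
From mathcomp Require Import all_boot all_order all_algebra all_field.
From mathcomp Require Import boolp classical_sets.

Set Implicit Arguments.
Unset Strict Implicit.
Unset Printing Implicit Defensive.

Import Order.TTheory GRing.Theory Num.Theory.
Local Open Scope ring_scope.
Local Open Scope classical_set_scope.

Definition F (R : comNzRingType) (k : int) (X Y : R) : R :=
  X ^+ 3 - k%:~R * X ^+ 2 * Y - (k + 3)%:~R * X * Y ^+ 2 - Y ^+ 3.

Definition f (k : int) : {poly rat} := F k 'X 1.

(* The splitting field of p inside algC, the algebraic closure of the rationals: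
   the smallest subfield containing all roots of p. Since x / 0 = 0, a subset
   is divring_closed exactly when it is a subfield. *)
Definition splitting_field (p : {poly rat}) : set algC :=
  smallest (fun S : set algC => GRing.divring_closed (mem S))
    [set z : algC | root (map_poly ratr p) z].

Definition L (k : int) : set algC := splitting_field (f k).

Definition same_field_param (m n : int) : Prop :=
  [/\ n != m, n != - m - 3 & L n = L m].

Definition nontrivial_solution (m lambda x y : int) : Prop :=
  [/\ 0 < lambda, (lambda %| m ^+ 2 + 3 * m + 9)%Z,
      x * y * (x + y) != 0 & F m x y = lambda].

Definition correspondence (m N x y : int) : Prop :=
  N%:~R = m%:~R + (m ^+ 2 + 3 * m + 9)%:~R * (x * y * (x + y))%:~R
                  / (F m x y)%:~R :> rat.

(* Main.v *)
(* The order-three map s(z) = -1/(1+z) permutes the roots of every f_k, and it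
   generates the Galois group of L_k over Q.  The rational Moebius maps that
   commute with s are z -> (y z - x)/(x z + y + x); such a map sends the roots
   of f_m to the roots of f_N, where
   N = m + (m^2+3m+9) x y (x+y) / F_m(x,y).
   Conversely, let t and e in L_m be roots of f_m and f_n on which the Galois
   group acts through s in the same way (replace e by 1/e and n by -n-3 if
   needed).  Then (e t + e + 1)/(t - e) is Galois invariant, hence a rational
   y/x, and e is the image of t under the map above.  In lowest terms F_m(x,y)
   is coprime to x y (x+y), so N is an integer exactly when F_m(x,y) divides
   m^2+3m+9.  Finally m^2+3m+9 is odd and x y (x+y) is even, so N = m mod 2:
   this tells N from -N-3 and excludes N = -m-3. *)
From HB Require Import structures.
Require Import Defs.
From mathcomp Require Import all_boot all_order all_algebra all_field.
From mathcomp Require Import boolp classical_sets.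
From mathcomp Require Import zify ring.

Import Order.TTheory GRing.Theory Num.Theory.
Local Open Scope ring_scope.

(** * The forms F_k: identities, parity and divisibility *)

Definition mobius3 {K : fieldType} (z : K) : K := - (1 + z)^-1.

(** With x = [b] and y = [a], the bracket containing [n] is F_k(x,y)(N - n). At a root [t] of f_k
    the other term drops out, so the identity serves both ways: to send roots to roots, and to
    recover n from an image root. *)
Lemma F_mobius (R : comNzRingType) (k n : int) (a b t : R) :
  F k b a * F n (a * t - b) (b * t + a + b) =
  - (a ^+ 2 + a * b + b ^+ 2) ^+ 3 * F k t 1
  + (k%:~R * F k b a + (k ^+ 2 + 3 * k + 9)%:~R * (b * a * (b + a))
     - n%:~R * F k b a) *
    ((a * t - b) * (b * t + a + b) * ((a * t - b) + (b * t + a + b))).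
Proof. rewrite /F; ring. Qed.

Lemma rmorph_F (R S : comNzRingType) (phi : {rmorphism R -> S}) (k : int)
  (x y : R) : phi (F k x y) = F k (phi x) (phi y).
Proof. by rewrite /F !(rmorphB, rmorphM, rmorphXn) /= !rmorph_int. Qed.

Lemma F_int (R : comNzRingType) (k x y : int) :
  (F k x y)%:~R = F k x%:~R y%:~R :> R.
Proof. by rewrite /F !intz; ring. Qed.

Lemma F_homog (R : comNzRingType) (k : int) (c x y : R) :
  F k (c * x) (c * y) = c ^+ 3 * F k x y.
Proof. rewrite /F; ring. Qed.

Lemma parity (x : int) : exists j, x = 2 * j \/ x = 2 * j + 1.
Proof. exists (x %/ 2)%Z; lia. Qed.

Lemma conductor_odd (m : int) : exists e, m ^+ 2 + 3 * m + 9 = 2 * e + 1.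
Proof.
case: (parity m) => j [] ->; [exists (2 * j ^+ 2 + 3 * j + 4)
  | exists (2 * j ^+ 2 + 5 * j + 6)]; ring.
Qed.

Lemma conductor_gt0 (m : int) : 0 < m ^+ 2 + 3 * m + 9.
Proof. nia. Qed.

Lemma triple_even (x y : int) : exists h, x * y * (x + y) = 2 * h.
Proof.
case: (parity x) => i [] ->; case: (parity y) => j [] ->.
- exists (i * (2 * j) * (2 * i + 2 * j)); ring.
- exists (i * (2 * j + 1) * (2 * i + (2 * j + 1))); ring.
- exists ((2 * i + 1) * j * (2 * i + 1 + 2 * j)); ring.
- exists ((2 * i + 1) * (2 * j + 1) * (i + j + 1)); ring.
Qed.

(** Whatever k is, F_k(x,y) is odd unless x and y are both even. *)
Lemma F_eq0_even (k x y : int) : F k x y = 0 -> (2 %| x)%Z && (2 %| y)%Z.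
Proof.
rewrite /F !intz.
case: (parity k) => l [] ->; case: (parity x) => i [] ->;
  case: (parity y) => j [] -> => e; lia.
Qed.

Lemma coprimezMDl (q d c : int) : coprimez d c -> coprimez (q * d + c) d.
Proof.
move=> /coprimezP[[u v] /= uv]; apply/coprimezP; exists (v, u - v * q) => /=.
by rewrite -uv; ring.
Qed.

(** Modulo x, y and x+y the form reduces to -y^3, x^3 and y^3, which are units there because x and y
    are coprime. *)
Lemma F_coprime_dvd (k x y : int) : coprimez x y ->
  (F k x y %| (k ^+ 2 + 3 * k + 9) * (x * y * (x + y)))%Z ->
  (F k x y %| k ^+ 2 + 3 * k + 9)%Z.
Proof.
move=> cxy; rewrite Gauss_dvdzl // !coprimezMr -andbA; apply/and3P; split.
- have -> : F k x y =
      (x ^+ 2 - k * x * y - (k + 3) * y ^+ 2) * x + - y ^+ 3.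
    by rewrite /F !intz; ring.
  by apply: coprimezMDl; rewrite coprimezN coprimezXr.
- have -> : F k x y =
      (- k * x ^+ 2 - (k + 3) * x * y - y ^+ 2) * y + x ^+ 3.
    by rewrite /F !intz; ring.
  by apply: coprimezMDl; rewrite coprimezXr // coprimez_sym.
- have -> : F k x y =
      (x ^+ 2 - (k + 1) * x * y - 2 * y ^+ 2) * (x + y) + y ^+ 3.
    by rewrite /F !intz; ring.
  apply: coprimezMDl; apply: coprimezXr.
  by have := @coprimezMDl 1 y x; rewrite mul1r addrC coprimez_sym => ->.
Qed.

(** Written in lowest terms, a rational root would have even numerator and denominator. *)
Lemma F_rat_neq0 (k : int) (x : rat) : F k x 1 != 0.
Proof.
apply/eqP => e.
have d0 : (denq x)%:~R != 0 :> rat by rewrite intr_eq0 denq_neq0.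
have : F k (numq x) (denq x) = 0.
  apply: (@intr_inj rat); rewrite F_int numqE mulrC -[X in F _ _ X]mulr1.
  by rewrite F_homog e mulr0.
move/F_eq0_even => /andP[en ed].
have : (2 %| gcdz (numq x) (denq x))%Z by rewrite dvdz_gcd en ed.
by rewrite /gcdz (eqP (coprime_num_den x)).
Qed.

(** * Roots of f_k and their conjugates *)

Local Notation evalC p z := (map_poly ratr p : {poly algC}).[z].

Lemma horner_F (R : comNzRingType) (k : int) (z : R) :
  (F k 'X 1).[z] = F k z 1.
Proof. by rewrite -horner_evalE rmorph_F /= rmorph1 horner_evalE hornerX. Qed.

Lemma horner_f (k : int) (z : algC) : evalC (f k) z = F k z 1.
Proof. by rewrite /f rmorph_F /= map_polyX rmorph1 horner_F. Qed.

Lemma size_f (k : int) : size (f k) = 4%N.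
Proof.
have -> : f k = Poly [:: -1; - (k + 3)%:~R; - k%:~R; 1].
  rewrite /f /F /= !cons_poly_def !rmorphN /= !rmorph_int polyC0 polyC1; ring.
by rewrite (@PolyK _ 0) /= ?oner_eq0.
Qed.

Lemma f_irreducible (k : int) : irreducible_poly (f k).
Proof.
apply: cubic_irreducible => [|x]; first by rewrite size_f.
by rewrite /root horner_F F_rat_neq0.
Qed.

Section Roots.
Variables (k : int) (t : algC).
Hypothesis t_root : F k t 1 = 0.

Lemma root_neq_rat (r : rat) : t != ratr r.
Proof.
apply/eqP => e; move: t_root; rewrite e.
rewrite -[X in F _ _ X](rmorph1 (ratr : {rmorphism rat -> algC})) -rmorph_F.
by move/eqP; rewrite fmorph_eq0; apply/negP/F_rat_neq0.
Qed.

Lemma root_neq0 : t != 0.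
Proof. by have := root_neq_rat 0; rewrite rmorph0. Qed.

Lemma root_add1_neq0 : 1 + t != 0.
Proof. by have := root_neq_rat (-1); rewrite rmorphN1 -addr_eq0 addrC. Qed.

Lemma root_lin_neq0 (a b : rat) : (a != 0) || (b != 0) ->
  ratr a * t + ratr b != 0.
Proof.
have [->|a0] := eqVneq a 0; first by rewrite /= rmorph0 mul0r add0r fmorph_eq0.
move=> _; apply/eqP => e; have := root_neq_rat (- b / a); apply/negP/negPn/eqP.
rewrite fmorph_div /= rmorphN /=; apply: (canRL (mulfK _)).
  by rewrite fmorph_eq0.
by apply/eqP; rewrite -addr_eq0 mulrC e.
Qed.

Lemma mobius3_root : F k (mobius3 t) 1 = 0.
Proof.
have n1 := root_add1_neq0.
have -> : F k (mobius3 t) 1 = - F k t 1 / (1 + t) ^+ 3.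
  by rewrite /F /mobius3; field.
by rewrite t_root oppr0 mul0r.
Qed.

(** Turns s into a polynomial on the roots, so that other polynomials can be composed with it. *)
Lemma mobius3_poly : mobius3 t = t ^+ 2 - (k + 1)%:~R * t - 2.
Proof.
have n1 := root_add1_neq0; apply: (mulfI n1).
rewrite /mobius3 mulrN divff //; apply/eqP; rewrite eq_sym -subr_eq0 -t_root /F.
by apply/eqP; ring.
Qed.

Lemma mobius3_mobius3 : mobius3 (mobius3 t) = - (1 + t) / t.
Proof.
have n1 := root_add1_neq0; have n0 := root_neq0.
have e : 1 + mobius3 t = t / (1 + t) by rewrite /mobius3; field.
by rewrite {1}/mobius3 e; field; rewrite n0 n1.
Qed.

Lemma root_cases (z : algC) : F k z 1 = 0 ->
  [\/ z = t, z = mobius3 t | z = mobius3 (mobius3 t)].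
Proof.
move=> z_root; have n1 := root_add1_neq0; have n0 := root_neq0.
(* The monic cubic with roots t, s(t), s(s(t)) differs from f_k by a multiple of F_k(t,1). *)
have : (z - t) * (z - mobius3 t) * (z - mobius3 (mobius3 t)) = 0.
  have -> : (z - t) * (z - mobius3 t) * (z - mobius3 (mobius3 t)) =
    F k z 1 - (z ^+ 2 + z) * F k t 1 / (t * (1 + t)).
    by rewrite mobius3_mobius3 /mobius3 /F; field; rewrite n0 n1.
  by rewrite z_root t_root mulr0 mul0r subrr.
by move/eqP; rewrite !mulf_eq0 !subr_eq0 => /orP[/orP[]|] /eqP; constructor.
Qed.

(** The fixed points of s are the roots of X^2+X+1. Dividing f_k by it leaves k - 3X, so a common
    root would be the rational k/3. *)
Lemma root_quadratic_neq0 : t ^+ 2 + t + 1 != 0.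
Proof.
apply/eqP => q; have := root_neq_rat (k%:~R / 3).
rewrite fmorph_div /= ratr_int ratr_nat; apply/negP/negPn/eqP.
have : k%:~R - t * 3 = F k t 1 - (t - 1 - k%:~R) * (t ^+ 2 + t + 1).
  by rewrite /F; ring.
rewrite t_root q mulr0 subrr => /eqP; rewrite subr_eq0 => /eqP ->.
by rewrite mulfK // pnatr_eq0.
Qed.

Lemma mobius3_neq : mobius3 t != t.
Proof.
have n1 := root_add1_neq0; apply/eqP => e; have := root_quadratic_neq0.
have -> : t ^+ 2 + t + 1 = (1 + t) * (t - mobius3 t) by rewrite /mobius3; field.
by rewrite e subrr mulr0 eqxx.
Qed.

Lemma mobius3_mobius3_neq : mobius3 (mobius3 t) != t.
Proof.
have n0 := root_neq0; rewrite mobius3_mobius3; apply/eqP => e.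
have := root_quadratic_neq0.
have -> : t ^+ 2 + t + 1 = t * (t - - (1 + t) / t) by field.
by rewrite e subrr mulr0 eqxx.
Qed.

(** For fixed t, F_k(t,1) is affine in k with slope -t(1+t), which is nonzero at a root. *)
Lemma root_param_inj (n : int) : F n t 1 = 0 -> n = k.
Proof.
move=> e; apply/eqP; rewrite -(@eqr_int algC) -subr_eq0.
have : (n%:~R - k%:~R) * (t * (1 + t)) = F k t 1 - F n t 1 by rewrite /F; ring.
rewrite t_root e subrr => /eqP.
by rewrite !mulf_eq0 (negPf root_neq0) (negPf root_add1_neq0) !orbF.
Qed.

(** Stands in for the Galois action: f_k is irreducible, so a rational polynomial relation at one
    root holds at every root. *)
Lemma horner_root_conj (p : {poly rat}) (z : algC) :
  evalC p t = 0 -> F k z 1 = 0 -> evalC p z = 0.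
Proof.
move=> pt zr.
have [/dvdpP[q ->]|] := boolP (f k %| p).
  by rewrite rmorphM hornerM horner_f zr mulr0.
rewrite -irreducible_poly_coprime; last exact: f_irreducible.
move=> /Bezout_eq1_coprimepP[[u v] /= uv].
have : evalC (u * f k + v * p) t = 1 by rewrite uv rmorph1 hornerC.
rewrite rmorphD !rmorphM /= !hornerE horner_f pt t_root !mulr0 addr0.
by move=> /esym/eqP; rewrite oner_eq0.
Qed.

(** A Bezout relation with the irreducible f_k inverts q(t) inside Q[t]; if q(t) = 0, the quotient
    is 0 by convention. *)
Lemma horner_root_div (p q : {poly rat}) :
  exists u, evalC p t / evalC q t = evalC u t.
Proof.
have [q0|q0] := eqVneq (evalC q t) 0.
  by exists 0; rewrite q0 invr0 mulr0 rmorph0 horner0.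
have : coprimep (f k) q.
  rewrite irreducible_poly_coprime; last exact: f_irreducible.
  apply: contra q0 => /dvdpP[h ->].
  by rewrite rmorphM hornerM horner_f t_root mulr0.
move=> /Bezout_eq1_coprimepP[[u v] /= uv]; exists (p * v).
have : evalC (u * f k + v * q) t = 1 by rewrite uv rmorph1 hornerC.
rewrite rmorphD !rmorphM /= !hornerE horner_f t_root mulr0 add0r => vq.
by rewrite -[X in X / _]mulr1 -vq mulrA mulfK.
Qed.

End Roots.

(* A polynomial of degree at most 2 taking the same value at the three
   conjugates of [t] is constant. *)
Lemma horner_invariant_rat (k : int) (t : algC) (q : {poly rat}) :
  F k t 1 = 0 -> evalC q (mobius3 t) = evalC q t ->
  exists r, evalC q t = ratr r.
Proof.
move=> t0 q1; have t1 := mobius3_root _ _ t0; have t2 := mobius3_root _ _ t1.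
have red z : F k z 1 = 0 -> evalC q z = evalC (q %% f k) z.
  move=> zr; rewrite {1}(divp_eq q (f k)) rmorphD rmorphM /= hornerD hornerM.
  by rewrite horner_f zr mulr0 add0r.
pose g : {poly rat} := 'X ^+ 2 - (k + 1)%:~R * 'X - 2.
have gE z : evalC g z = z ^+ 2 - (k + 1)%:~R * z - 2.
  rewrite -horner_evalE !(rmorphB, rmorphM, rmorphXn) /= !rmorph_int.
  by rewrite !rmorph_nat map_polyX horner_evalE hornerX.
(* The relation q(g(t)) = q(t) is conjugated to s(t), which gives the third value. *)
have q2 : evalC q (mobius3 (mobius3 t)) = evalC q (mobius3 t).
  have : evalC (q \Po g - q) (mobius3 t) = 0.
    apply: (horner_root_conj _ _ t0) => //.
    rewrite rmorphB /= hornerD hornerN map_comp_poly horner_comp gE.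
    by rewrite -mobius3_poly // q1 subrr.
  rewrite rmorphB /= hornerD hornerN map_comp_poly horner_comp gE.
  by rewrite -mobius3_poly // => /eqP; rewrite subr_eq0 => /eqP.
pose h := map_poly ratr (q %% f k) - (evalC q t)%:P : {poly algC}.
have h0 : h = 0.
  apply/eqP/negPn/negP => hn0.
  have : (3 < size h)%N.
    apply: (@max_poly_roots _ _ [:: t; mobius3 t; mobius3 (mobius3 t)]) => //=.
      rewrite /root !hornerD !hornerN !hornerC -!red //.
      by rewrite q2 q1 subrr eqxx.
    rewrite !inE negb_or andbT eq_sym (mobius3_neq _ _ t0).
    by rewrite eq_sym (mobius3_mobius3_neq _ _ t0) eq_sym (mobius3_neq _ _ t1).
  apply/negP; rewrite -leqNgt; apply: (leq_trans (size_polyD _ _)).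
  rewrite geq_max size_polyN size_map_poly (leq_trans (size_polyC_leq1 _)) //.
  rewrite andbT -ltnS -(size_f k) ltn_modp irredp_neq0 //.
  exact: f_irreducible.
exists (q %% f k)`_0; have /(congr1 (fun p : {poly algC} => p`_0)) := h0.
rewrite coefB coefC coef0 coef_map /= => /eqP.
by rewrite subr_eq0 => /eqP.
Qed.

(** * The splitting fields L_k *)

Lemma L_sub (k : int) (S : set algC) : GRing.divring_closed (mem S) ->
  (forall z : algC, F k z 1 = 0 -> S z) -> (L k `<=` S)%classic.
Proof.
by move=> cS rS z; apply; split=> // w /=; rewrite /root horner_f => /eqP/rS.
Qed.

Lemma root_L (k : int) (z : algC) : F k z 1 = 0 -> L k z.
Proof.
by move=> zr S [_]; apply; rewrite /= /root horner_f zr.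
Qed.

Lemma L_divring_closed (k : int) : GRing.divring_closed (mem (L k)).
Proof.
split=> [|x y|x y].
- by rewrite inE => S [/= [S1 _ _] _]; rewrite inE in S1.
- rewrite !inE => Lx Ly S SP; have [/= [_ SB _] _] := SP.
  by have := SB x y; rewrite !inE; apply; [apply: Lx | apply: Ly].
- rewrite !inE => Lx Ly S SP; have [/= [_ _ SD] _] := SP.
  by have := SD x y; rewrite !inE; apply; [apply: Lx | apply: Ly].
Qed.

(** Q[t] is a subfield and contains all three roots, so it contains the smallest such subfield. *)
Lemma L_horner (k : int) (t z : algC) : F k t 1 = 0 -> L k z ->
  exists p : {poly rat}, z = evalC p t.
Proof.
move=> tr.
apply: (@L_sub k [set z | exists p : {poly rat}, z = evalC p t]%classic).
  split=> [|x y|x y]; rewrite ?inE /=.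
  - by exists 1; rewrite rmorph1 hornerC.
  - move=> [p ->] [q ->]; exists (p - q).
    by rewrite rmorphB hornerD hornerN.
  - move=> [p ->] [q ->]; exact: horner_root_div tr p q.
move=> w /(root_cases _ _ tr).
have X : t = evalC 'X t by rewrite map_polyX hornerX.
case=> ->.
- by exists 'X.
- have [u uE] := horner_root_div _ _ tr (-1) (1 + 'X); exists u.
  rewrite -uE rmorphN1 rmorphD !rmorph1 /= map_polyX.
  by rewrite hornerD hornerN hornerX !hornerC mulN1r.
- have [u uE] := horner_root_div _ _ tr (- (1 + 'X)) 'X; exists u.
  rewrite -uE rmorphN rmorphD !rmorph1 /= map_polyX.
  by rewrite hornerN hornerD hornerX !hornerC (mobius3_mobius3 _ _ tr).
Qed.

(** * From a Moebius relation to equal fields *)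

(* [correspondence k n x y] with the denominator cleared. *)
Definition mobius_relation (k n x y : int) : Prop :=
  n * F k x y = k * F k x y + (k ^+ 2 + 3 * k + 9) * (x * y * (x + y)).

Lemma mobius_relationE (R : numDomainType) (k n x y : int) :
  mobius_relation k n x y <->
  n%:~R * (F k x y)%:~R = k%:~R * (F k x y)%:~R +
    (k ^+ 2 + 3 * k + 9)%:~R * (x%:~R * y%:~R * (x%:~R + y%:~R)) :> R.
Proof.
rewrite /mobius_relation; set c := _ + 9; set h := F k x y.
rewrite -(intrD R x y) -!intrM -intrD.
by split=> [->|/intr_inj].
Qed.

(** Up to a scalar, the inverse of the matrix with rows (y, -x) and (x, x+y) is the matrix of the
    same shape for the pair (-x, y+x). *)
Lemma mobius_relation_inv (k n x y : int) : mobius_relation k n x y ->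
  mobius_relation n k (- x) (y + x).
Proof.
rewrite /mobius_relation => /eqP; rewrite -subr_eq0 => /eqP e; apply/eqP.
rewrite -subr_eq0; apply/eqP/oppr_inj; rewrite oppr0 -[RHS]e /F !intz; ring.
Qed.

Lemma F_int_neq0 (k x y : int) : (x != 0) || (y != 0) -> F k x y != 0.
Proof.
have [->|y0 _] := eqVneq y 0.
  rewrite orbF => x0; have -> : F k x 0 = x ^+ 3 by rewrite /F; ring.
  exact: expf_neq0.
have y0' : y%:~R != 0 :> rat by rewrite intr_eq0.
rewrite -(@intr_eq0 rat) F_int -[X in F _ X](mulfVK y0') mulrC.
rewrite -[X in F _ _ X]mulr1 F_homog mulf_neq0 ?expf_neq0 //.
exact: F_rat_neq0.
Qed.

Lemma root_intlin_neq0 (k : int) (t : algC) (a b : int) : F k t 1 = 0 ->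
  a != 0 -> a%:~R * t + b%:~R != 0.
Proof.
move=> tr a0; have := root_lin_neq0 k t tr a%:~R b%:~R.
by rewrite !ratr_int !intr_eq0 a0; apply.
Qed.

Lemma mobius_root (k n x y : int) (t : algC) : mobius_relation k n x y ->
  x != 0 -> F k t 1 = 0 ->
  F n ((y%:~R * t - x%:~R) / (x%:~R * t + y%:~R + x%:~R)) 1 = 0.
Proof.
move=> rel x0 tr; set u := _ - _; set v := _ + _.
have v0 : v != 0.
  rewrite /v -addrA -intrD; exact: root_intlin_neq0 tr x0.
have : F k x%:~R y%:~R * F n u v = 0.
  rewrite F_mobius tr mulr0 add0r -!F_int.
  by rewrite (iffLR (mobius_relationE algC _ _ _ _) rel) subrr mul0r.
move/eqP; rewrite mulf_eq0 -F_int intr_eq0 (negPf (F_int_neq0 k x y _)) ?x0 //=.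
have {1}-> : u = v * (u / v) by rewrite mulrC mulfVK.
rewrite -[X in F _ _ X]mulr1 F_homog mulf_eq0 expf_eq0 /= (negPf v0).
by move/eqP.
Qed.

Lemma rpred_mobius (K : fieldType) (S : divringClosed K) (x y : int) (t : K) :
  t \in S -> (y%:~R * t - x%:~R) / (x%:~R * t + y%:~R + x%:~R) \in S.
Proof.
move=> St; have SZ (z : int) : z%:~R \in S by exact: rpred_int.
by apply: rpred_div; rewrite ?rpredB ?rpredD ?rpredM.
Qed.

(** The inverse map sends a root e of f_n to a root t of f_k, and e is a rational function of t. *)
Lemma L_sub_mobius (k n x y : int) : mobius_relation k n x y ->
  x * y * (x + y) != 0 -> (L n `<=` L k)%classic.
Proof.
rewrite !mulf_eq0 !negb_or -andbA => rel /and3P[x0 y0 xy0].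
apply: L_sub; first exact: L_divring_closed.
move=> e er; have Nx0 : - x != 0 by rewrite oppr_eq0.
have tr := mobius_root _ _ _ _ _ (mobius_relation_inv _ _ _ _ rel) Nx0 er.
set t := (_ / _ : algC) in tr.
have vt : x%:~R * t + y%:~R + x%:~R != 0.
  rewrite -addrA -intrD; exact: root_intlin_neq0 tr x0.
have ve : - x%:~R * e + y%:~R != 0.
  by have := root_intlin_neq0 _ _ _ y er Nx0; rewrite intrN.
have -> : e = (y%:~R * t - x%:~R) / (x%:~R * t + y%:~R + x%:~R).
  apply: (mulIf vt); rewrite mulfVK //.
  have tE : t * (- x%:~R * e + y%:~R) = (y + x)%:~R * e + x%:~R.
    have vE : (- x)%:~R * e + (y + x)%:~R + (- x)%:~R = - x%:~R * e + y%:~R.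
      by ring.
    by rewrite /t vE mulfVK // intrN opprK.
  apply/eqP; rewrite -subr_eq0; apply/eqP.
  transitivity ((y + x)%:~R * e + x%:~R - t * (- x%:~R * e + y%:~R)).
    by ring.
  by rewrite tE subrr.
(* Gives L_k the structure that the closure lemma [rpred_mobius] expects. *)
pose S : divringClosed algC := HB.pack_for (divringClosed algC)
  (mem (L k) : {pred algC})
  (GRing.isDivringClosed.Build _ _ (L_divring_closed k)).
apply: set_mem; apply: (@rpred_mobius _ S).
by apply: mem_set; apply: root_L; exact: tr.
Qed.

Lemma L_mobius (k n x y : int) : mobius_relation k n x y ->
  x * y * (x + y) != 0 -> L n = L k.
Proof.
move=> rel s0; rewrite eqEsubset; split; first exact: L_sub_mobius rel s0.
apply: L_sub_mobius (mobius_relation_inv _ _ _ _ rel) _; move: s0.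
by rewrite !mulf_eq0 oppr_eq0 addrCA addNr addr0 (addrC y) orbAC.
Qed.

(** * From equal fields to a Moebius relation *)

Lemma mobius_of_root (k n : int) (t : algC) (p : {poly rat}) :
  F k t 1 = 0 -> F n (evalC p t) 1 = 0 ->
  evalC p (mobius3 t) = mobius3 (evalC p t) -> n != k ->
  exists x y : int,
    [/\ coprimez x y, x * y * (x + y) != 0 & mobius_relation k n x y].
Proof.
move=> tr; set e := evalC p t => er pe nk.
have te : t - e != 0.
  rewrite subr_eq0; apply: contra nk => /eqP te; apply/eqP.
  by apply: root_param_inj tr _ _; rewrite te.
have n1 := root_add1_neq0 _ _ tr; have m1 := root_add1_neq0 _ _ er.
have te1 : mobius3 t - mobius3 e != 0.
  have -> : mobius3 t - mobius3 e = (t - e) / ((1 + t) * (1 + e)).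
    by rewrite /mobius3; field; rewrite n1 m1.
  by rewrite mulf_neq0 ?invr_eq0 ?mulf_neq0.
(* q(t) is the quotient (e t + e + 1)/(t - e), as a polynomial in t. *)
have [q qE] := horner_root_div _ _ tr (p * 'X + p + 1) ('X - p).
have ev z : evalC (p * 'X + p + 1) z = evalC p z * z + evalC p z + 1.
  by rewrite !rmorphD rmorphM /= map_polyX rmorph1 !hornerE.
have ev' z : evalC ('X - p) z = z - evalC p z.
  by rewrite rmorphB /= map_polyX !hornerE.
rewrite ev ev' -/e in qE.
(* Conjugating the equation that defines q replaces t and e by s(t) and s(e), which leaves the
   quotient unchanged. *)
have qE1 : evalC q (mobius3 t) = evalC q t.
  have : evalC (q * ('X - p) - (p * 'X + p + 1)) (mobius3 t) = 0.
    apply: (horner_root_conj _ _ tr); last exact: mobius3_root.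
    rewrite rmorphB rmorphM hornerD hornerN hornerM ev ev' -/e -qE mulfVK //.
    by rewrite subrr.
  rewrite rmorphB rmorphM hornerD hornerN hornerM ev ev' pe => /eqP.
  rewrite subr_eq0 => /eqP h; apply: (mulIf te1); rewrite h -qE.
  by rewrite /mobius3; field; rewrite n1 m1 te.
have [r rE] := horner_invariant_rat _ _ _ tr qE1.
have b0 : (denq r)%:~R != 0 :> algC by rewrite intr_eq0 denq_neq0.
have aE : (numq r)%:~R = ratr r * (denq r)%:~R :> algC.
  by rewrite -[LHS]ratr_int numqE rmorphM /= ratr_int.
exists (denq r), (numq r); set b := denq r in b0 aE *; set a := numq r in aE *.
have cop : coprimez b a by rewrite coprimezE coprime_sym coprime_num_den.
have bn0 : b != 0 by rewrite denq_neq0.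
set v := b%:~R * t + a%:~R + b%:~R.
have v0 : v != 0 by rewrite /v -addrA -intrD; exact: root_intlin_neq0 tr bn0.
have uE : a%:~R * t - b%:~R = v * e.
  have : ratr r * (t - e) = e * t + e + 1 by rewrite -rE -qE mulfVK.
  rewrite /v aE => h.
  apply/eqP; rewrite -subr_eq0; apply/eqP.
  transitivity (b%:~R * (ratr r * (t - e) - (e * t + e + 1)) : algC).
    by ring.
  by rewrite h subrr mulr0.
have rel : mobius_relation k n b a.
  apply/(mobius_relationE algC).
  (* Both F_k(t,1) and the value of F_n at the image vanish, so the last product is zero; its second
     factor is nonzero, hence n = N. *)
  have := F_mobius _ k n a%:~R b%:~R t; rewrite tr mulr0 add0r -/v uE.
  rewrite -[X in F n _ X]mulr1 F_homog er !mulr0 -!F_int => /esym/eqP.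
  have -> : v * e + v = v * (1 + e) by ring.
  have /negPf w0 : v * e * v * (v * (1 + e)) != 0.
    by rewrite !mulf_neq0 // (root_neq0 _ _ er).
  by rewrite mulf_eq0 w0 orbF subr_eq0 => /eqP.
split=> //; apply: contra nk => /eqP s0; apply/eqP.
have F0 : F k b a != 0 by rewrite F_int_neq0 ?bn0.
by move: rel; rewrite /mobius_relation s0 mulr0 addr0 => /(mulIf F0).
Qed.

(** The polynomial f_n(p(X)) vanishes at t, hence at its conjugate s(t). *)
Lemma horner_root_param (k n : int) (t : algC) (p : {poly rat}) :
  F k t 1 = 0 -> F n (evalC p t) 1 = 0 -> F n (evalC p (mobius3 t)) 1 = 0.
Proof.
move=> tr; have ev z : F n (evalC p z) 1 = evalC (f n \Po p) z.
  by rewrite map_comp_poly horner_comp horner_f.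
rewrite !ev => e; apply: (horner_root_conj _ _ tr) => //.
exact: mobius3_root.
Qed.

Lemma F_inv (K : fieldType) (n : int) (z : K) : z != 0 ->
  F (- n - 3) z^-1 1 = - F n z 1 / z ^+ 3.
Proof. by move=> z0; rewrite /F; field. Qed.

Lemma root_exists (k : int) : exists t : algC, F k t 1 = 0.
Proof.
have /closed_rootP[t] : size (map_poly ratr (f k) : {poly algC}) != 1%N.
  by rewrite size_map_poly size_f.
by rewrite /root horner_f => /eqP; exists t.
Qed.

(* The generator of the Galois group acts on the roots of [f n] as [mobius3]
   or as its inverse; inverting the roots turns [n] into [- n - 3] and
   exchanges the two cases. *)
Lemma mobius_of_same_field (m n : int) : same_field_param m n ->
  exists N x y : int, [/\ N = n \/ N = - n - 3, coprimez x y,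
    x * y * (x + y) != 0 & mobius_relation m N x y].
Proof.
case=> nm nm3 Lnm; have [t tr] := root_exists m; have [e er] := root_exists n.
have [p eE] : exists p : {poly rat}, e = evalC p t.
  by apply: L_horner tr _; rewrite -Lnm; exact: root_L.
rewrite eE in er; set e' := evalC p t in er.
have [] := root_cases _ _ er _ (horner_root_param _ _ _ _ tr er) => pe.
(* If e were fixed, it would be rational, which no root of f_n is. *)
- have [r rE] := horner_invariant_rat _ _ _ tr pe.
  by have := root_neq_rat _ _ er r; rewrite /e' rE eqxx.
- have [x [y [cxy s0 rel]]] := mobius_of_root _ _ _ _ tr er pe nm.
  by exists n, x, y; split=> //; left.
have e0 := root_neq0 _ _ er; have e1 := root_add1_neq0 _ _ er.
(* In the remaining case e goes to s(s(e)); its inverse, written u(t), goes to s(u(t)). *)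
have [u uE] := horner_root_div _ _ tr 1 p.
rewrite rmorph1 hornerC mul1r -/e' in uE.
have ur : F (- n - 3) (evalC u t) 1 = 0.
  by rewrite -uE F_inv // er oppr0 mul0r.
have ue : evalC u (mobius3 t) = mobius3 (evalC u t).
  have : evalC (p * u - 1) (mobius3 t) = 0.
    apply: (horner_root_conj _ _ tr); last exact: mobius3_root.
    by rewrite rmorphB rmorphM rmorph1 /= !hornerE -/e' -uE divff // subrr.
  rewrite rmorphB rmorphM rmorph1 /= !hornerE pe (mobius3_mobius3 _ _ er) -uE.
  move=> /eqP; rewrite subr_eq0 => /eqP h.
  have c0 : - (1 + e') / e' != 0 by rewrite mulf_neq0 ?oppr_eq0 ?invr_eq0.
  apply: (mulfI c0); rewrite h.
  have i1 : 1 + e'^-1 = (1 + e') / e' by field.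
  by rewrite /mobius3 i1; field; rewrite e0 e1.
have nm' : - n - 3 != m.
  by apply: contra nm3 => /eqP <-; apply/eqP; ring.
have [x [y [cxy s0 rel]]] := mobius_of_root _ _ _ _ tr ur ue nm'.
by exists (- n - 3), x, y; split=> //; right.
Qed.

(** * Integer solutions and the parity of N *)

Lemma correspondenceP (m N x y : int) : F m x y != 0 ->
  correspondence m N x y <-> mobius_relation m N x y.
Proof.
move=> F0; have F0' : (F m x y)%:~R != 0 :> rat by rewrite intr_eq0.
apply: iff_trans (iff_sym (mobius_relationE rat _ _ _ _)).
rewrite /correspondence !intrM intrD; split=> [->|e].
  by rewrite mulrDl mulfVK.
by apply: (mulIf F0'); rewrite mulrDl mulfVK.
Qed.

(** Integrality of N makes F_m(x,y) divide m^2+3m+9. If the value is negative, (x,y) is replaced by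
    (-x,-y): both cubic forms change sign and N stays the same. *)
Lemma solution_of_mobius (m N x y : int) : coprimez x y ->
  x * y * (x + y) != 0 -> mobius_relation m N x y ->
  exists lambda x y : int,
    nontrivial_solution m lambda x y /\ correspondence m N x y.
Proof.
move=> cxy s0 rel.
have x0 : x != 0 by move: s0; rewrite !mulf_eq0 !negb_or => /andP[/andP[]].
have F0 : F m x y != 0 by rewrite F_int_neq0 ?x0.
have FD : (F m x y %| m ^+ 2 + 3 * m + 9)%Z.
  apply: F_coprime_dvd cxy _; apply/dvdzP; exists (N - m).
  by rewrite mulrBl rel; ring.
have [Fpos|Fneg] := ltP 0 (F m x y).
  by exists (F m x y), x, y; split=> //; apply/correspondenceP.
have FN : F m (- x) (- y) = - F m x y by rewrite /F; ring.
exists (- F m x y), (- x), (- y); split; first split=> //.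
- by rewrite oppr_gt0 lt_neqAle F0.
- by move: FD; rewrite !dvdzE abszN.
- by rewrite -opprD mulrNN mulrN oppr_eq0.
- apply/correspondenceP; first by rewrite FN oppr_eq0.
  rewrite /mobius_relation FN !mulrN rel; ring.
Qed.

(** [lambda] divides an odd number, so it is odd, while [lambda] (N - m) is even. *)
Lemma mobius_relation_parity (m N lambda x y : int) :
  nontrivial_solution m lambda x y -> mobius_relation m N x y ->
  (2 %| N - m)%Z.
Proof.
case=> _ /dvdzP[d dE] _ Fl; rewrite /mobius_relation Fl.
have [e eE] := conductor_odd m; have [h ->] := triple_even x y => rel.
case: (parity (N - m)) => j [] Nm; first by rewrite Nm dvdz_mulr.
have : lambda * (2 * j + 1) = (m ^+ 2 + 3 * m + 9) * (2 * h).
  by rewrite -Nm mulrBr mulrC rel; ring.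
rewrite eE in dE *; move=> h1.
case: (parity lambda) => l [] lE; rewrite lE in dE h1; lia.
Qed.

Theorem theorem1p1 (m : int) :
  [/\ (exists n : int, same_field_param m n) <->
      (exists lambda x y : int, nontrivial_solution m lambda x y),
      (forall n : int, same_field_param m n ->
         exists! N : int, (N = n \/ N = - n - 3) /\
           exists lambda x y : int,
             nontrivial_solution m lambda x y /\ correspondence m N x y)
    & (forall lambda x y : int, nontrivial_solution m lambda x y ->
         exists n : int, same_field_param m n /\
           exists N : int, (N = n \/ N = - n - 3) /\ correspondence m N x y)].
Proof.
have param_of_solution lambda x y : nontrivial_solution m lambda x y ->
    exists n, same_field_param m n /\ mobius_relation m n x y.
  move=> sol; have [l0 /dvdzP[d dE] s0 Fl] := sol.
  (* This is N itself, with d = (m^2+3m+9)/[lambda]. *)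
  exists (m + d * (x * y * (x + y))).
  have rel : mobius_relation m (m + d * (x * y * (x + y))) x y.
    by rewrite /mobius_relation dE Fl; ring.
  split=> //; have D0 := conductor_gt0 m; split.
  - rewrite -subr_eq0 addrC addKr mulf_neq0 //.
    by apply: contraTneq D0 => d0; rewrite dE d0 mul0r ltxx.
  (* N = -m-3 would make N - m = -2m-3 odd. *)
  - apply/eqP => Nm; have := mobius_relation_parity _ _ _ _ _ sol rel.
    by rewrite Nm; lia.
  - exact: L_mobius rel s0.
have solution_of_param n : same_field_param m n -> exists N : int,
    (N = n \/ N = - n - 3) /\ exists lambda x y : int,
      nontrivial_solution m lambda x y /\ correspondence m N x y.
  move=> /mobius_of_same_field[N [x [y [Nn cxy s0 rel]]]].
  by exists N; split=> //; exact: solution_of_mobius cxy s0 rel.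
have corr_parity N lambda x y : nontrivial_solution m lambda x y ->
    correspondence m N x y -> (2 %| N - m)%Z.
  move=> sol /correspondenceP rel.
  apply: (mobius_relation_parity _ _ _ _ _ sol).
  by apply: rel; case: sol => l0 _ _ ->; rewrite gt_eqF.
split.
- split=> [[n /solution_of_param[N [_ [l [x [y [sol _]]]]]]]|].
    by exists l, x, y.
  by move=> [l [x [y /param_of_solution[n [nP _]]]]]; exists n.
- move=> n /solution_of_param[N [Nn NP]]; exists N; split=> // N'.
  move=> [Nn' [l' [x' [y' [sol' cor']]]]].
  have [l [x [y [sol cor]]]] := NP.
  have := corr_parity _ _ _ _ sol cor; have := corr_parity _ _ _ _ sol' cor'.
  (* n and -n-3 have opposite parities, so only one is congruent to m modulo 2. *)
  by case: Nn => ->; case: Nn' => ->; lia.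
- move=> l x y sol; have [n [nP rel]] := param_of_solution _ _ _ sol.
  exists n; split=> //; exists n; split; first by left.
  by apply/correspondenceP => //; case: sol => l0 _ _ ->; rewrite gt_eqF.
Qed.
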